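(* Let $H$ be a complex Hilbert space and let $(f_i)_{i\in I}$ be a frame for $H$, with $I$ a countable index set. Then the following are equivalent: (i) there exist scalars $a,b\in\mathbb{C}$ and orthonormal bases $(g_i)_{i\in I}$ and $(h_i)_{i\in I}$ for $H$ such that $f_i=a g_i+b h_i$ for all $i\in I$; (ii) $(f_i)_{i\in I}$ is a Riesz basis for $H$.
   Context: A family $(f_i)_{i\in I}$ in a Hilbert space $H$ is a frame for $H$ if there are constants $0<A\le B$ such that $A\|x\|^2\le\sum_{i\in I}|\langle x,f_i\rangle|^2\le B\|x\|^2$ for all $x\in H$. A family $(f_i)_{i\in I}$ is a Riesz basis for $H$ if there are an orthonormal basis $(e_i)_{i\in I}$ for $H$ and a bounded invertible operator $T:H\to H$ (with bounded inverse) such that $Te_i=f_i$ for all $i\in I$. *)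

(* Defs.v *)
From HB Require Import structures.
From mathcomp Require Export all_boot all_order all_algebra.
From mathcomp Require Export complex.
From mathcomp Require Export all_classical all_reals all_analysis.

Set Implicit Arguments.
Unset Strict Implicit.
Unset Printing Implicit Defensive.

Import Order.TTheory GRing.Theory Num.Theory.
Import numFieldNormedType.Exports.

Local Open Scope classical_set_scope.
Local Open Scope ring_scope.
Local Open Scope complex_scope.

(* A complex Hilbert space is a complete normed module over R[i] together with
   an inner product, linear in its first argument, that induces the norm. *)
Definition induces_norm (R : realType) (H : normedModType R[i])
    (inner : {dot H for Num.conj}) : Prop :=
  forall x : H, `|x| ^+ 2 = inner x x.

(* Norms of a normedModType R[i] are elements of R[i] with imaginary part 0;
   rnorm is the same norm with values in R. On R[i] it is the modulus. *)
Definition rnorm (R : realType) (V : normedZmodType R[i]) (x : V) : R :=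
  complex.Re `|x|.

Section HilbertFamilies.
Variables (R : realType) (H : completeNormedModType R[i]).
Variables (inner : {dot H for Num.conj}) (I : countType).
Implicit Types e f : I -> H.

Definition frame f : Prop :=
  exists A B : R, [/\ 0 < A, A <= B & forall x : H,
    ((A * rnorm x ^+ 2)%:E <=
       \esum_(i in [set: I]) (rnorm (inner x (f i)) ^+ 2)%:E)%E /\
    (\esum_(i in [set: I]) (rnorm (inner x (f i)) ^+ 2)%:E <=
       (B * rnorm x ^+ 2)%:E)%E].

Definition orthonormal_family e : Prop :=
  forall i j : I, inner (e i) (e j) = (i == j)%:R.

Definition linear_span e : set H :=
  [set x | exists (s : seq I) (c : I -> R[i]), x = \sum_(i <- s) c i *: e i].

(* A Hilbert basis: the finite linear combinations are dense in H and
   need not exhaust it. *)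
Definition orthonormal_basis e : Prop :=
  orthonormal_family e /\ dense (linear_span e).

Definition bounded_operator (T : {linear H -> H}) : Prop :=
  exists M : R, forall x : H, rnorm (T x) <= M * rnorm x.

Definition bounded_invertible (T : {linear H -> H}) : Prop :=
  bounded_operator T /\
  exists S : {linear H -> H}, [/\ bounded_operator S, cancel T S & cancel S T].

Definition riesz_basis f : Prop :=
  exists (e : I -> H) (T : {linear H -> H}),
    [/\ orthonormal_basis e, bounded_invertible T & forall i, T (e i) = f i].

End HilbertFamilies.

(* Main.v *)
From HB Require Import structures.
Require Import Defs.
From mathcomp Require Import ring lra.
From mathcomp Require finmap.

Set Implicit Arguments.
Unset Strict Implicit.
Unset Printing Implicit Defensive.

Import Order.TTheory GRing.Theory Num.Theory.
Import numFieldNormedType.Exports.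

Local Open Scope ring_scope.
Local Open Scope complex_scope.

(** If [f i = a g_i + b h_i], let [W] be the unitary operator carrying the basis
    [g] to the basis [h]; then [f i = T g_i] for [T = a + b W].  Since [W] is
    unitary, [T] commutes with its adjoint [T'], so [T x] and [T' x] have the
    same norm.  Bessel's inequality bounds the frame sum of [x] by the squared
    norm of [T' x], hence the lower frame bound makes [T'] bounded below, [T]
    bounded below, and [T T'] coercive.  The Lax-Milgram theorem makes [T T']
    onto, so [T] is onto too and has a bounded inverse
    ([sum_of_bases_riesz]).

    Conversely let [f i = T e_i] with [T] invertible, [G = T' T] and
    [N = G^-1].  In the polar decomposition [T = U |T|], the positive part is a
    multiple of the mean of the unitary operator
    [|T|/r + i sqrt (1 - |T|^2/r^2)] and its adjoint, for large [r].  Multiplied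
    by [U], this unitary becomes [T (1/r + i sqrt (N - 1/r^2))], so that a single
    square root has to be constructed: with [c > 0] small
    and [K = sqrt (N - c^2)], the operators [T (c + i K)] and [T (c - i K)] are
    unitary, because [K] is self-adjoint, commutes with [G], and
    [(c - i K) (c + i K) = N = G^-1].  They add up to [2 c T], so applying them
    to the basis [e] gives two orthonormal bases whose sum is [2 c f]
    ([riesz_sum_of_bases]).

    Three tools carry the argument.  A bounded coercive operator [A] satisfies
    [|x - t A x| <= q |x|] for some [t > 0] and [q < 1]
    ([coercive_contraction]); this yields both the Lax-Milgram theorem, by a
    fixed-point iteration, and the square root of [A] when it is self-adjoint,
    by an iteration for [1 - sqrt (1 - B)] with [B = 1 - t A].  The
    Riesz-Fischer theorem ([riesz_fischer]) yields operators with prescribed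
    coefficients in a basis, in particular the adjoint of [T] and the unitary
    [W].  Limits are taken with the real-valued norm, so that estimates live in
    the ordered field [R] and not in the partially ordered [R[i]]. *)

(** * The real-valued norm *)

Section RealNorm.
Variable R : realType.
Implicit Types V : normedZmodType R[i].

Lemma normr_rnorm V (x : V) : `|x| = (rnorm x)%:C.
Proof. by rewrite /rnorm RRe_real// normr_real. Qed.

Lemma rnorm_ge0 V (x : V) : 0 <= rnorm x.
Proof. by have := normr_ge0 x; rewrite normr_rnorm ler0c. Qed.

Lemma rnorm0 V : rnorm (0 : V) = 0.
Proof. by rewrite /rnorm normr0. Qed.

Lemma rnorm_eq0 V (x : V) : rnorm x = 0 -> x = 0.
Proof. by move=> x0; apply/normr0_eq0; rewrite normr_rnorm x0. Qed.

Lemma rnormN V (x : V) : rnorm (- x) = rnorm x.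
Proof. by rewrite /rnorm normrN. Qed.

Lemma rdistC V (x y : V) : rnorm (x - y) = rnorm (y - x).
Proof. by rewrite -rnormN opprB. Qed.

Lemma rnormD V (x y : V) : rnorm (x + y) <= rnorm x + rnorm y.
Proof. by have := ler_normD x y; rewrite !normr_rnorm -rmorphD lecR. Qed.

Lemma rdistD V (y x z : V) : rnorm (x - z) <= rnorm (x - y) + rnorm (y - z).
Proof. by rewrite -(subrKA y x (- z)) rnormD. Qed.

Lemma rnormZ (V : normedModType R[i]) a (x : V) :
  rnorm (a *: x) = rnorm a * rnorm x.
Proof. by apply: complexI; rewrite rmorphM /= -!normr_rnorm normrZ. Qed.

Lemma rnorm_real (r : R) : rnorm (r%:C) = `|r|.
Proof. by apply: complexI; rewrite -normr_rnorm normc_def /= expr0n addr0 sqrtr_sqr. Qed.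

Lemma sqr_rnormC (z : R[i]) : (rnorm z ^+ 2)%:C = z * Num.conj z.
Proof. by rewrite rmorphXn /= -normr_rnorm normCK. Qed.

Lemma Re_le_rnorm (z : R[i]) : complex.Re z <= rnorm z.
Proof.
by have := normc_ge_Re z; rewrite normr_rnorm lecR; apply: le_trans; rewrite ler_norm.
Qed.

Lemma ReJ (z : R[i]) : complex.Re (Num.conj z) = complex.Re z.
Proof. by case: z. Qed.

Lemma conjR (r : R) : Num.conj (r%:C) = r%:C.
Proof. exact: conjc_real. Qed.

Lemma ReM_real (r : R) (z : R[i]) : complex.Re (r%:C * z) = r * complex.Re z.
Proof. by case: z => a b /=; rewrite mul0r subr0. Qed.

End RealNorm.

(** * Limits of sequences *)

Section RealLimits.
Variable R : realType.

(** Convergence of sequences in [V], with the error measured in [R].  It serves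
    both for vectors and for scalars such as inner products. *)
Definition tends (V : normedZmodType R[i]) (u : nat -> V) (l : V) :=
  forall eps : R, 0 < eps -> exists N, forall n, (N <= n)%N -> rnorm (u n - l) <= eps.

Implicit Types V W : normedZmodType R[i].

Lemma rnorm_small V (x : V) : (forall eps : R, 0 < eps -> rnorm x <= eps) -> x = 0.
Proof.
move=> small; apply: rnorm_eq0; apply/eqP; rewrite eq_le rnorm_ge0 andbT.
by rewrite leNgt; apply/negP => x0; have := small (rnorm x / 2) ltac:(lra); lra.
Qed.

Lemma tends_unique V (u : nat -> V) l l' : tends u l -> tends u l' -> l = l'.
Proof.
move=> ul ul'; apply/eqP; rewrite -subr_eq0; apply/eqP/rnorm_small => eps eps0.
have [N uN] := ul (eps / 2) ltac:(lra); have [N' uN'] := ul' (eps / 2) ltac:(lra).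
have := rdistD (u (maxn N N')) l l'; rewrite (rdistC l (u _)).
by have := uN _ (leq_maxl N N'); have := uN' _ (leq_maxr N N'); lra.
Qed.

Lemma tends_ext V (u v : nat -> V) l : u =1 v -> tends u l -> tends v l.
Proof.
move=> uv ul eps /ul[N uN]; exists N => n /uN; by rewrite uv.
Qed.

Lemma tends_cst V (l : V) : tends (fun=> l) l.
Proof. by move=> eps eps0; exists 0%N => n _; rewrite subrr rnorm0 ltW. Qed.

Lemma tends_shift V (u : nat -> V) l : tends u l -> tends (fun n => u n.+1) l.
Proof. by move=> ul eps /ul[N uN]; exists N => n Nn; apply: uN; apply: leqW. Qed.

Lemma tendsD V (u v : nat -> V) l l' :
  tends u l -> tends v l' -> tends (fun n => u n + v n) (l + l').
Proof.
move=> ul vl' eps eps0.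
have [N uN] := ul (eps / 2) ltac:(lra); have [N' vN'] := vl' (eps / 2) ltac:(lra).
exists (maxn N N') => n; rewrite geq_max => /andP[/uN un /vN' vn].
by rewrite opprD addrACA; apply: le_trans (rnormD _ _) _; lra.
Qed.

Lemma tends_lipschitz V W (u : nat -> V) l (v : nat -> W) l' (M : R) :
  tends u l -> (forall n, rnorm (v n - l') <= M * rnorm (u n - l)) -> tends v l'.
Proof.
move=> ul vM eps eps0.
have M1 : 0 < `|M| + 1 by rewrite ltr_wpDl.
have [N uN] := ul (eps / (`|M| + 1)) (divr_gt0 eps0 M1).
exists N => n /uN; rewrite ler_pdivlMr// => un; apply: le_trans (vM n) _.
have := ler_norm M; have := rnorm_ge0 (u n - l); nra.
Qed.

Lemma tends_le V (u : nat -> V) l (B : R) :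
  tends u l -> (forall n, rnorm (u n) <= B) -> rnorm l <= B.
Proof.
move=> ul uB; rewrite leNgt; apply/negP => lB.
have [N /(_ N (leqnn _)) uN] := ul ((rnorm l - B) / 2) ltac:(lra).
have := rdistD (u N) l 0; rewrite !subr0 (rdistC l).
have := uB N; lra.
Qed.

(** The Cauchy criterion for bounded monotone real sequences is the source of
    all convergence below: vector sequences are compared with such a sequence. *)
Lemma bounded_monotone_cauchy (s : nat -> R) (M : R) :
  {homo s : m n / (m <= n)%N >-> m <= n} -> (forall n, s n <= M) ->
  forall eps, 0 < eps -> exists N, forall m n, (N <= m)%N -> (m <= n)%N -> s n - s m <= eps.
Proof.
move=> s_incr sM eps eps0; pose E : set R := range s.
have Esup : has_sup E by split; [exists (s 0%N), 0%N | exists M => _ [n _ <-]].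
have [_ [N _ <-] sN] := sup_adherent eps0 Esup.
exists N => m n Nm mn; have := s_incr _ _ Nm.
have : s n <= sup E by apply: ub_le_sup; [case: Esup | exists n].
lra.
Qed.

Lemma complete_tends (H : completeNormedModType R[i]) (u : nat -> H) :
  (forall eps : R, 0 < eps -> exists N, forall m n, (N <= m)%N -> (m <= n)%N ->
     rnorm (u n - u m) <= eps) ->
  exists l, tends u l.
Proof.
move=> cu.
have : cauchy (u @ \oo)%classic.
  apply/cauchy_exP => e e0.
  have eR : e = (complex.Re e)%:C by rewrite RRe_real// ger0_real// ltW.
  rewrite eR ltcR in e0.
  have [N uN] := cu (complex.Re e / 2) ltac:(lra).
  exists (u N); exists N => // n /= Nn.
  rewrite -ball_normE /ball_ /= normr_rnorm rdistC eR ltcR.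
  by have := uN N n (leqnn _) Nn; lra.
move/cauchy_cvgP/cvg_ex => [l ul]; exists l => eps eps0.
have /(_ _) := @cvgr_distC_lt _ _ _ _ _ _ _ ul.
move=> /(_ eps%:C); rewrite ltcR => /(_ eps0) [N _ uN].
by exists N => n /uN /=; rewrite normr_rnorm ltcR => /ltW.
Qed.

(** The increments are dominated by those of the partial sums [s] of a
    geometric series. *)
Lemma geometric_tends (H : completeNormedModType R[i]) (u : nat -> H) (C q : R) :
  0 <= q < 1 -> (forall n, rnorm (u n.+1 - u n) <= C * q ^+ n) -> exists l, tends u l.
Proof.
move=> /andP[q0 q1] uq; apply: complete_tends.
have C0 : 0 <= C by have := uq 0%N; rewrite expr0 mulr1; apply: le_trans; apply: rnorm_ge0.
pose s n := C * (1 - q ^+ n) / (1 - q).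
have sS n : s n.+1 - s n = C * q ^+ n by rewrite /s exprS; field; lra.
have s_incr : {homo s : m n / (m <= n)%N >-> m <= n}.
  apply: homo_leq => //; first exact: le_trans.
  by move=> n; rewrite -subr_ge0 sS mulr_ge0// exprn_ge0.
have s_bnd n : s n <= C / (1 - q).
  rewrite /s ler_pM2r ?invr_gt0; last by lra.
  by rewrite ler_piMr// gerBl exprn_ge0.
move=> eps /(bounded_monotone_cauchy s_incr s_bnd)[N sN]; exists N => m n Nm mn.
apply: le_trans (sN m n Nm mn) => {Nm}.
elim: n mn => [|n IHn]; first by rewrite leqn0 => /eqP->; rewrite !subrr rnorm0.
rewrite leq_eqVlt ltnS => /predU1P[->|/IHn {}IHn]; first by rewrite !subrr rnorm0.
by have := rdistD (u n) (u n.+1) (u m); have := uq n; rewrite -sS; lra.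
Qed.

End RealLimits.

(** * The inner product *)

Section InnerProduct.
Variables (R : realType) (H : completeNormedModType R[i]).
Variables (inner : {dot H for Num.conj}) (Hinner : induces_norm inner).
Local Notation "<| x , y |>" := (inner x y) (at level 0, x, y at level 99).

Lemma ipDl x y z : <|x + y, z|> = <|x, z|> + <|y, z|>.
Proof. exact: linearDl. Qed.
Lemma ipDr x y z : <|x, y + z|> = <|x, y|> + <|x, z|>.
Proof. exact: linearDr. Qed.
Lemma ipBl x y z : <|x - y, z|> = <|x, z|> - <|y, z|>.
Proof. exact: linearBl. Qed.
Lemma ipBr x y z : <|x, y - z|> = <|x, y|> - <|x, z|>.
Proof. exact: linearBr. Qed.
Lemma ipZl a x y : <|a *: x, y|> = a * <|x, y|>.
Proof. exact: linearZl_LR. Qed.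
Lemma ipZr a x y : <|x, a *: y|> = Num.conj a * <|x, y|>.
Proof. exact: linearZr_LR. Qed.
Lemma ip0l x : <|0, x|> = 0.
Proof. exact: linear0l. Qed.
Lemma ip0r x : <|x, 0|> = 0.
Proof. exact: linear0r. Qed.
Lemma ipC x y : <|x, y|> = Num.conj <|y, x|>.
Proof. by rewrite hermC expr0 mul1r. Qed.
Lemma ip_suml (J : Type) (s : seq J) (F : J -> H) y :
  <|\sum_(j <- s) F j, y|> = \sum_(j <- s) <|F j, y|>.
Proof. by elim/big_ind2: _ => [|? ? ? ? <- <-|//]; rewrite ?ip0l ?ipDl. Qed.
Lemma ip_sumr (J : Type) (s : seq J) (F : J -> H) x :
  <|x, \sum_(j <- s) F j|> = \sum_(j <- s) <|x, F j|>.
Proof. by elim/big_ind2: _ => [|? ? ? ? <- <-|//]; rewrite ?ip0r ?ipDr. Qed.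

Lemma ipxx x : <|x, x|> = (rnorm x ^+ 2)%:C.
Proof. by rewrite -Hinner normr_rnorm rmorphXn. Qed.

Lemma sqr_rnorm x : rnorm x ^+ 2 = complex.Re <|x, x|>.
Proof. by rewrite ipxx. Qed.

Lemma sqr_rnormD x y :
  rnorm (x + y) ^+ 2 = rnorm x ^+ 2 + rnorm y ^+ 2 + 2 * complex.Re <|x, y|>.
Proof.
rewrite !sqr_rnorm ipDl !ipDr !raddfD /= [in <|y, x|>]ipC ReJ; ring.
Qed.

Lemma sqr_rnormB x y :
  rnorm (x - y) ^+ 2 = rnorm x ^+ 2 + rnorm y ^+ 2 - 2 * complex.Re <|x, y|>.
Proof.
by rewrite sqr_rnormD rnormN -scaleN1r ipZr rmorphN rmorph1 mulN1r raddfN; ring.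
Qed.

(** The vector [<y,y> x - <x,y> y] has squared norm
    [|y|^2 (|y|^2 |x|^2 - |<x,y>|^2)], which is nonnegative. *)
Lemma cauchy_schwarz x y : rnorm <|x, y|> <= rnorm x * rnorm y.
Proof.
have [->|y0] := eqVneq y 0; first by rewrite ip0r !rnorm0 mulr0.
have ry0 : 0 < rnorm y.
  by rewrite lt_def rnorm_ge0 andbT; apply: contra_neq y0; apply: rnorm_eq0.
rewrite -ler_sqr ?nnegrE ?mulr_ge0 ?rnorm_ge0//.
pose u := <|y, y|> *: x - <|x, y|> *: y.
have uE : <|u, u|> =
    (rnorm y ^+ 2 * (rnorm y ^+ 2 * rnorm x ^+ 2 - rnorm <|x, y|> ^+ 2))%:C.
  rewrite /u ipBl !ipBr !ipZl !ipZr (ipC y x) !ipxx !conjR.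
  have := sqr_rnormC <|x, y|>; rewrite !(rmorphB, rmorphXn, rmorphM) /= => ->; ring.
have : 0 <= rnorm u ^+ 2 by rewrite sqr_ge0.
rewrite sqr_rnorm uE /= pmulr_rge0 ?exprn_gt0// subr_ge0 => h.
by rewrite exprMn mulrC.
Qed.

End InnerProduct.

(** * Bounded operators *)

Section Operators.
Variables (R : realType) (H : completeNormedModType R[i]).
Implicit Types A B G T : {linear H -> H}.

Lemma linear_bundle (F : H -> H) : linear F -> exists L : {linear H -> H}, L =1 F.
Proof.
move=> Flin; pose L : {linear H -> H} := HB.pack F (GRing.isLinear.Build _ _ _ _ F Flin).
by exists L.
Qed.

Lemma bounded_pos T : bounded_operator T ->
  exists M : R, 0 < M /\ forall x, rnorm (T x) <= M * rnorm x.
Proof.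
move=> [M TM]; exists (`|M| + 1); split=> [|x]; first by rewrite ltr_wpDl.
by apply: le_trans (TM x) _; have := ler_norm M; have := rnorm_ge0 x; nra.
Qed.

Lemma bounded_comp A B : bounded_operator A -> bounded_operator B ->
  bounded_operator (A \o B).
Proof.
move=> /bounded_pos[M [M0 AM]] [N BN]; exists (M * N) => x /=.
by apply: le_trans (AM _) _; rewrite -mulrA ler_pM2l ?BN.
Qed.

Lemma tends_bounded A (u : nat -> H) l : bounded_operator A ->
  tends u l -> tends (fun n => A (u n)) (A l).
Proof.
by move=> [M AM] ul; apply: (tends_lipschitz (M := M) ul) => n; rewrite -linearB.
Qed.

(** The lower bound gives injectivity and bounds the inverse by [c^-1]. *)
Lemma bounded_below_inverse T (c : R) : 0 < c ->
  (forall x, c * rnorm x <= rnorm (T x)) -> (forall y, exists x, T x = y) ->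
  exists S : {linear H -> H}, [/\ bounded_operator S, cancel T S & cancel S T].
Proof.
move=> c0 Tc /choice[F TF].
have Tinj : injective T.
  move=> x y Txy; apply/eqP; rewrite -subr_eq0; apply/eqP/rnorm_eq0/eqP.
  have := Tc (x - y); rewrite linearB Txy subrr rnorm0 pmulr_rle0// => h.
  by rewrite eq_le h rnorm_ge0.
have Flin : linear F by move=> a x y; apply: Tinj; rewrite linearP !TF.
have [S SF] := linear_bundle Flin.
exists S; split=> [|x|x]; last by rewrite SF TF.
  exists c^-1 => x; rewrite SF mulrC ler_pdivlMr// mulrC.
  by have := Tc (F x); rewrite TF.
by apply: Tinj; rewrite SF TF.
Qed.

Variables (inner : {dot H for Num.conj}) (Hinner : induces_norm inner).
Local Notation "<| x , y |>" := (inner x y) (at level 0, x, y at level 99).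

Definition adjoint_pair A B := forall x y, <|A x, y|> = <|x, B y|>.

Lemma adjoint_pairC A B : adjoint_pair A B -> adjoint_pair B A.
Proof. by move=> AB x y; rewrite ipC -AB -ipC. Qed.

Lemma tends_ipl (u : nat -> H) l y : tends u l -> tends (fun n => <|u n, y|>) <|l, y|>.
Proof.
move=> ul; apply: (tends_lipschitz (M := rnorm y) ul) => n.
by rewrite -ipBl mulrC; apply: cauchy_schwarz.
Qed.

Lemma tends_ipr (u : nat -> H) l x : tends u l -> tends (fun n => <|x, u n|>) <|x, l|>.
Proof.
move=> ul; apply: (tends_lipschitz (M := rnorm x) ul) => n.
by rewrite -ipBr; apply: cauchy_schwarz.
Qed.

Definition coercive A (d : R) := forall x, d * rnorm x ^+ 2 <= complex.Re <|A x, x|>.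

(** Expanding the square, [|x - t A x|^2 <= (1 - 2 t d + t^2 M^2) |x|^2] when [M]
    bounds [A].  At [t = d / M^2] the factor is [1 - t d], which is at most
    [(1 - t d / 2)^2]; this avoids a square root in [q]. *)
Lemma coercive_contraction A d : 0 < d -> bounded_operator A -> coercive A d ->
  exists t q : R, [/\ 0 < t, 0 <= q < 1 &
    forall x, rnorm (x - t%:C *: A x) <= q * rnorm x].
Proof.
move=> d0 /bounded_pos[M0 [M0pos AM0]] Ad.
(* enlarging the bound by [d] ensures [t * d <= 1] *)
pose M := M0 + d; have Mpos : 0 < M by rewrite /M; lra.
have AM x : rnorm (A x) <= M * rnorm x.
  by apply: le_trans (AM0 x) _; have := rnorm_ge0 x; rewrite /M; nra.
pose t := d / M ^+ 2.
have t0 : 0 < t by rewrite divr_gt0// exprn_gt0.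
have tM : t * M ^+ 2 = d by rewrite mulfVK// gt_eqF// exprn_gt0.
have td : 0 < t * d <= 1.
  by rewrite mulr_gt0//= -mulrAC ler_pdivrMr ?exprn_gt0//  /M; nra.
clearbody t; exists t, (1 - t * d / 2); split=> //; first by move: td; lra.
move=> x; rewrite -ler_sqr ?nnegrE ?mulr_ge0 ?rnorm_ge0//; last by move: td; lra.
rewrite (sqr_rnormB Hinner) rnormZ rnorm_real gtr0_norm // ipZr conjR ReM_real.
rewrite ipC ReJ; set b := complex.Re _.
have bd : d * rnorm x ^+ 2 <= b by exact: Ad.
have := lerXn2r 2 (rnorm_ge0 (A x)) (mulr_ge0 (ltW Mpos) (rnorm_ge0 x)) (AM x).
rewrite !exprMn => aM.
have : t * (t * rnorm (A x) ^+ 2) <= t * (d * rnorm x ^+ 2).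
  by rewrite ler_pM2l// -tM -mulrA ler_pM2l.
have : t * (d * rnorm x ^+ 2) <= t * b by rewrite ler_pM2l.
have : 0 <= (t * d / 2) ^+ 2 * rnorm x ^+ 2 by rewrite mulr_ge0 ?sqr_ge0.
by move=> *; lra.
Qed.

(** A solution of [A x = y] is a fixed point of the contraction
    [x |-> x - t (A x - y)]; its iterates [u] converge geometrically. *)
Lemma contraction_onto A t q : 0 < t -> 0 <= q < 1 -> bounded_operator A ->
  (forall x, rnorm (x - t%:C *: A x) <= q * rnorm x) -> forall y, exists x, A x = y.
Proof.
move=> t0 q01 Abd Aq y.
pose u n := iter n (fun x => x - t%:C *: (A x - y)) 0.
have uS n : u n.+1 - u n = - (t%:C *: (A (u n) - y)) by rewrite /u iterS addrAC subrr add0r.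
clearbody u.
have [|l ul] := @geometric_tends R H u (rnorm (u 1%N - u 0%N)) q q01.
  elim=> [|n IHn]; first by rewrite expr0 mulr1.
  have -> : u n.+2 - u n.+1 = (u n.+1 - u n) - t%:C *: A (u n.+1 - u n).
    rewrite [A (_ - _)]linearB [t%:C *: (_ - _)]scalerBr uS [u n.+1 - u n]uS !scalerBr !opprB.
    by rewrite [RHS]addrA subrK.
  apply: le_trans (Aq _) _; rewrite exprS mulrCA ler_wpM2l//.
  by case/andP: q01.
exists l; apply/eqP; rewrite -subr_eq0.
have Al : tends (fun n => A (u n) - y) (A l - y).
  by apply: tendsD; [apply: tends_bounded | apply: tends_cst].
have dl : tends (fun n => u n.+1 - u n) (- (t%:C *: (A l - y))).
  apply: (tends_lipschitz (M := t) Al) => n.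
  by rewrite uS -opprD -scalerBr rnormN rnormZ rnorm_real gtr0_norm.
have d0 : tends (fun n => u n.+1 - u n) (l - l).
  apply: tendsD; first exact: tends_shift.
  by apply: (tends_lipschitz (M := 1) ul) => n; rewrite -opprD rnormN mul1r.
have /eqP := tends_unique dl d0.
by rewrite subrr oppr_eq0 scaler_eq0 (inj_eq (@complexI _) t 0) gt_eqF.
Qed.

(** Coercivity and the Cauchy-Schwarz inequality give [d |x| <= |A x|], and
    surjectivity comes from the contraction. *)
Lemma lax_milgram A d : 0 < d -> bounded_operator A -> coercive A d ->
  exists S : {linear H -> H}, [/\ bounded_operator S, cancel A S & cancel S A].
Proof.
move=> d0 Abd Ad; have [t [q [t0 q01 Aq]]] := coercive_contraction d0 Abd Ad.
apply: (bounded_below_inverse d0) => [x|]; last exact: contraction_onto Aq.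
have [->|x0] := eqVneq x 0; first by rewrite linear0 rnorm0 mulr0.
have rx0 : 0 < rnorm x.
  by rewrite lt_def rnorm_ge0 andbT; apply: contra_neq x0; apply: rnorm_eq0.
rewrite -(ler_pM2r rx0) -mulrA -expr2; apply: le_trans (Ad x) _.
by apply: le_trans (Re_le_rnorm _) _; apply: cauchy_schwarz.
Qed.

Section SquareRoot.
Variables (A : {linear H -> H}) (r : R).
Hypotheses (r01 : 0 <= r < 1) (Ar : forall x, rnorm (A x) <= r * rnorm x).
Hypothesis Aadj : adjoint_pair A A.

(** The iterates converge to [Y = 1 - sqrt (1 - A)], the small solution of
    [2 Y = A + Y^2]; being polynomials in [A], they inherit self-adjointness
    and commute with whatever commutes with [A]. *)
Fixpoint sqrt_iter n : {linear H -> H} :=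
  if n is m.+1 then 2^-1 \*: (A \+ (sqrt_iter m \o sqrt_iter m)) else \0.

Lemma sqrt_iter0 x : sqrt_iter 0 x = 0.
Proof. by []. Qed.

Lemma sqrt_iterS n x :
  sqrt_iter n.+1 x = 2^-1 *: (A x + sqrt_iter n (sqrt_iter n x)).
Proof. by []. Qed.

(* Chosen so that [(r + q^2) / 2 <= q] and [q < 1]: the ball of radius [q] is
   preserved by the iteration, and on it the iteration contracts by [q]. *)
Let q := (1 + r) / 2.

Lemma sqrt_q01 : 0 <= q < 1. Proof. by rewrite /q; move: r01; lra. Qed.

Lemma rnorm_half (x : H) : rnorm (2^-1 *: x) = rnorm x / 2.
Proof.
have -> : 2^-1 = (2^-1)%:C :> R[i] by rewrite fmorphV rmorph_nat.
by rewrite rnormZ rnorm_real ger0_norm ?invr_ge0// mulrC.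
Qed.

Lemma sqrt_iter_le n x : rnorm (sqrt_iter n x) <= q * rnorm x.
Proof.
have q01 := sqrt_q01; case/andP: (q01) => q0 q1.
elim: n x => [|n IHn] x; first by rewrite rnorm0 mulr_ge0 ?rnorm_ge0.
rewrite sqrt_iterS rnorm_half ler_pdivrMr//.
apply: le_trans (rnormD _ _) _.
have h1 := Ar x; have h2 := IHn (sqrt_iter n x); have h3 := IHn x.
have h4 : q * rnorm (sqrt_iter n x) <= q * (q * rnorm x) by rewrite ler_wpM2l.
have h5 : (r + q * q) * rnorm x <= (q * 2) * rnorm x.
  by rewrite ler_wpM2r ?rnorm_ge0//; move: r01; rewrite /q; nra.
lra.
Qed.

Lemma conj_half : Num.conj (2^-1 : R[i]) = 2^-1.
Proof. by rewrite fmorphV rmorph_nat. Qed.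

Lemma sqrt_iter_adj n : adjoint_pair (sqrt_iter n) (sqrt_iter n).
Proof.
elim: n => [|n IHn] x y; first by rewrite ip0l ip0r.
by rewrite !sqrt_iterS ipZl ipZr ipDl ipDr Aadj !IHn conj_half.
Qed.

Lemma sqrt_iter_comm (B : {linear H -> H}) n :
  (forall x, B (A x) = A (B x)) -> forall x, B (sqrt_iter n x) = sqrt_iter n (B x).
Proof.
move=> BA; elim: n => [|n IHn] x; first by rewrite linear0.
by rewrite !sqrt_iterS linearZ linearD /= BA !IHn.
Qed.

(** As iterates commute, [Y_{n+1}^2 - Y_n^2 = (Y_{n+1} + Y_n) (Y_{n+1} - Y_n)],
    so each step contracts the difference by half of [q + q]. *)
Lemma sqrt_iter_diff n x :
  rnorm (sqrt_iter n.+1 x - sqrt_iter n x) <= rnorm x * q ^+ n.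
Proof.
have q01 := sqrt_q01; case/andP: (q01) => q0 q1.
elim: n x => [|n IHn] x.
  rewrite sqrt_iterS !sqrt_iter0 addr0 subr0 rnorm_half expr0 mulr1.
  by have := Ar x; have := rnorm_ge0 x; move: r01; nra.
pose d := sqrt_iter n.+1 x - sqrt_iter n x.
have -> : sqrt_iter n.+2 x - sqrt_iter n.+1 x =
    2^-1 *: (sqrt_iter n.+1 d + sqrt_iter n d).
  rewrite [sqrt_iter n.+2 x]sqrt_iterS [in X in _ - X]sqrt_iterS -scalerBr.
  congr (_ *: _); rewrite opprD addrACA subrr add0r /d !linearB.
  rewrite [sqrt_iter n.+1 (sqrt_iter n x)]sqrt_iter_comm ?addrA ?subrK// => z.
  by rewrite sqrt_iter_comm.
rewrite rnorm_half ler_pdivrMr//; apply: le_trans (rnormD _ _) _.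
have h1 := sqrt_iter_le n.+1 d; have h2 := sqrt_iter_le n d.
have h3 : q * rnorm d <= q * (rnorm x * q ^+ n) by rewrite ler_wpM2l// IHn.
by rewrite exprS; lra.
Qed.

(** [Y] is the pointwise limit of the iterates. *)
Lemma sqrt_contraction : exists Y : {linear H -> H},
  [/\ bounded_operator Y, adjoint_pair Y Y,
      forall x, 2 *: Y x = A x + Y (Y x)
    & forall B : {linear H -> H}, bounded_operator B ->
        (forall x, B (A x) = A (B x)) -> forall x, B (Y x) = Y (B x)].
Proof.
have /choice[F lF] x : exists l, tends (fun n => sqrt_iter n x) l.
  by apply: (geometric_tends sqrt_q01) => n; apply: sqrt_iter_diff.
have Flin : linear F.
  move=> a x y; apply: tends_unique (lF _) _.
  apply: (tends_ext (u := fun n => a *: sqrt_iter n x + sqrt_iter n y)).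
    by move=> n; rewrite linearP.
  apply: tendsD (lF y); apply: (tends_lipschitz (M := rnorm a) (lF x)) => n.
  by rewrite -scalerBr rnormZ.
have [Y YF] := linear_bundle Flin.
have lY x : tends (fun n => sqrt_iter n x) (Y x) by rewrite YF.
exists Y; split.
- by exists q => x; apply: tends_le (lY x) _ => n; apply: sqrt_iter_le.
- move=> x y; apply: tends_unique (tends_ipl y (lY x)) _.
  apply: tends_ext (tends_ipr x (lY y)) => n; by rewrite sqrt_iter_adj.
- move=> x; apply: tends_unique (_ : tends (fun n => 2 *: sqrt_iter n.+1 x) _) _.
    apply: (tends_lipschitz (M := rnorm (2 : R[i])) (tends_shift (lY x))) => n.
    by rewrite -scalerBr rnormZ.
  apply: (tends_ext (u := fun n => A x + sqrt_iter n (sqrt_iter n x))).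
    by move=> n; rewrite sqrt_iterS scalerA divff ?scale1r// pnatr_eq0.
  apply: tendsD; first exact: tends_cst.
  have -> : Y (Y x) = 0 + Y (Y x) by rewrite add0r.
  apply: (tends_ext (u := fun n =>
    sqrt_iter n (sqrt_iter n x - Y x) + sqrt_iter n (Y x))).
    by move=> n; rewrite linearB subrK.
  apply: tendsD (lY _); apply: (tends_lipschitz (M := q) (lY x)) => n.
  by rewrite subr0; apply: sqrt_iter_le.
- move=> B Bbd BA x; apply: tends_unique (tends_bounded Bbd (lY x)) _.
  by apply: tends_ext (lY (B x)) => n; rewrite sqrt_iter_comm.
Qed.

End SquareRoot.

(** With [t] from [coercive_contraction], [M = t^-1 (1 - A)] where
    [A = 1 - t M] has norm less than 1, and [K = t^(-1/2) (1 - Y)]. *)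
Lemma coercive_sqrt M d : 0 < d -> bounded_operator M -> coercive M d ->
  adjoint_pair M M ->
  exists K : {linear H -> H},
  [/\ bounded_operator K, adjoint_pair K K, forall x, K (K x) = M x
    & forall B : {linear H -> H}, bounded_operator B ->
        (forall x, B (M x) = M (B x)) -> forall x, B (K x) = K (B x)].
Proof.
move=> d0 Mbd Md Madj; have [t [q [t0 q01 Mq]]] := coercive_contraction d0 Mbd Md.
have [A AE] : exists A : {linear H -> H}, A =1 (fun x => x - t%:C *: M x).
  apply: linear_bundle => a x y; rewrite [M _]linearP scalerDr scalerBr opprD addrACA.
  by rewrite !scalerA (mulrC a).
have [||Y [[m Yb] Yadj YE Yc]] := sqrt_contraction (A := A) q01.
- by move=> x; rewrite AE.
- by move=> x y; rewrite !AE ipBl ipBr ipZl ipZr Madj conjR.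
pose l := Num.sqrt t^-1.
have lt : l ^+ 2 * t = 1 by rewrite sqr_sqrtr ?invr_ge0 ?ltW// mulVf// gt_eqF.
have [K KE] : exists K : {linear H -> H}, K =1 (fun x => l%:C *: (x - Y x)).
  apply: linear_bundle => a x y; rewrite [Y _]linearP opprD addrACA -scalerBr.
  by rewrite scalerDr !scalerA (mulrC a).
exists K; split.
- exists (`|l| * (1 + m)) => x; rewrite KE rnormZ rnorm_real -mulrA ler_wpM2l//.
  by apply: le_trans (rnormD _ _) _; rewrite rnormN mulrDl mul1r lerD2l.
- by move=> x y; rewrite !KE ipZl ipZr conjR ipBl ipBr Yadj.
- move=> x; rewrite !KE [Y (_ *: _)]linearZ [Y (_ - _)]linearB /=.
  rewrite -scalerBr scalerA -rmorphM -expr2.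
  have -> : x - Y x - (Y x - Y (Y x)) = t%:C *: M x.
    have YY : Y (Y x) = Y x + Y x - (x - t%:C *: M x).
      by rewrite -mulr2n -scaler_nat YE AE addrC addKr.
    by rewrite YY !opprB (addrAC (Y x + Y x)) addrK addrA subrK addrC subrK.
  by rewrite scalerA -rmorphM lt scale1r.
- move=> B Bbd BM x; have BA z : B (A z) = A (B z).
    by rewrite !AE [B (_ - _)]linearB [B (_ *: _)]linearZ /= BM.
  by rewrite !KE [B (_ *: _)]linearZ [B (_ - _)]linearB /= Yc.
Qed.

End Operators.

(** * Orthonormal families and coefficients *)

Section Families.
Variables (R : realType) (H : completeNormedModType R[i]).
Variables (inner : {dot H for Num.conj}) (Hinner : induces_norm inner).
Variable I : countType.
Implicit Types (e f : I -> H) (c : I -> R[i]) (s : seq I).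
Local Notation "<| x , y |>" := (inner x y) (at level 0, x, y at level 99).

(** Density is used through sequences: an identity that is continuous in [z]
    passes from [S] to the whole space. *)
Lemma dense_tends (S : set H) z : dense S ->
  exists w : nat -> H, (forall n, S (w n)) /\ tends w z.
Proof.
move=> Sd.
have /choice[w wP] (n : nat) : exists x : H, S x /\ rnorm (x - z) < n.+1%:R^-1.
  have n0 : 0 < (n.+1%:R^-1 : R)%:C by rewrite ltcR invr_gt0.
  have [|x [bx Sx]] := Sd (ball z (n.+1%:R^-1)%:C) _ (ball_open _ _).
    by exists z; apply: ballxx.
  exists x; split=> //; move: bx; rewrite -ball_normE /ball_ /= normr_rnorm ltcR.
  by rewrite rdistC.
exists w; split=> [n|eps eps0]; first by case: (wP n).
exists (Num.truncn eps^-1) => n Nn; have [_ /ltW wn] := wP n.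
apply: le_trans wn _; rewrite -[leRHS]invrK lef_pV2 ?posrE ?invr_gt0//.
by apply/ltW/(lt_le_trans (truncnS_gt _)); rewrite ler_nat.
Qed.

Lemma ip_orthonormal_sum e c s i : orthonormal_family inner e -> uniq s ->
  <|\sum_(j <- s) c j *: e j, e i|> = if i \in s then c i else 0.
Proof.
move=> eo us; rewrite ip_suml.
transitivity (\sum_(j <- s | j == i) c j).
  by rewrite [RHS]big_mkcond; apply: eq_bigr => j _; rewrite ipZl eo; case: eqP;
     rewrite ?mulr1 ?mulr0.
case: ifPn => si; last first.
  by rewrite big_seq_cond big1 // => j /andP[js /eqP ji]; rewrite -ji js in si.
by rewrite -big_filter filter_pred1_uniq// big_seq1.
Qed.

Lemma sqr_rnorm_orthonormal_sum e c s : orthonormal_family inner e -> uniq s ->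
  rnorm (\sum_(j <- s) c j *: e j) ^+ 2 = \sum_(j <- s) rnorm (c j) ^+ 2.
Proof.
move=> eo us; apply: complexI; rewrite -(ipxx Hinner) ip_sumr rmorph_sum /=.
rewrite big_seq [RHS]big_seq; apply: eq_bigr => j js.
by rewrite ipZr ip_orthonormal_sum// js sqr_rnormC mulrC.
Qed.

(** The difference of [x] and its partial expansion has nonnegative squared
    norm, and that squared norm is the difference of the two sides. *)
Lemma bessel e x s : orthonormal_family inner e -> uniq s ->
  \sum_(i <- s) rnorm <|x, e i|> ^+ 2 <= rnorm x ^+ 2.
Proof.
move=> eo us; pose c i := <|x, e i|>; pose y := \sum_(i <- s) c i *: e i.
have : 0 <= rnorm (x - y) ^+ 2 by rewrite sqr_ge0.
rewrite (sqr_rnormB Hinner) sqr_rnorm_orthonormal_sum//.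
have -> : complex.Re <|x, y|> = \sum_(i <- s) rnorm (c i) ^+ 2.
  rewrite /y ip_sumr; transitivity (complex.Re (\sum_(i <- s) rnorm (c i) ^+ 2)%:C) => //.
  congr complex.Re; rewrite rmorph_sum; apply: eq_bigr => i _.
  by rewrite /= ipZr sqr_rnormC mulrC.
by rewrite /c; lra.
Qed.

Lemma orthonormal_basis_total e y : orthonormal_basis inner e ->
  (forall i, <|y, e i|> = 0) -> y = 0.
Proof.
move=> [_ /(dense_tends y)[w [wS wy]]] y0.
have yw0 n : <|y, w n|> = 0.
  have [s [c ->]] := wS n; rewrite ip_sumr big1// => i _; by rewrite ipZr y0 mulr0.
have yy : <|y, y|> = 0.
  apply: tends_unique (tends_ipr Hinner y wy) _.
  exact: tends_ext (fun n => esym (yw0 n)) (tends_cst 0).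
by apply/rnorm_eq0/eqP; rewrite -sqrf_eq0 (sqr_rnorm Hinner) yy.
Qed.

(** Both sides of the adjunction are antilinear and continuous in the second
    vector, so the identity extends from the basis by density. *)
Lemma adjoint_on_basis e (C T : {linear H -> H}) : orthonormal_basis inner e ->
  bounded_operator T -> (forall x i, <|C x, e i|> = <|x, T (e i)|>) ->
  adjoint_pair inner C T.
Proof.
move=> [_ ed] Tb CT x z; have [w [wS wz]] := dense_tends z ed.
apply: tends_unique (tends_ipr Hinner (C x) wz) _.
apply: tends_ext (tends_ipr Hinner x (tends_bounded Tb wz)) => n.
have [s [c ->]] := wS n; rewrite linear_sum !ip_sumr; apply: eq_bigr => i _.
by rewrite linearZ /= !ipZr CT.
Qed.

(** [pmap pickle_inv (iota m n)] lists the indices with code between [m] and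
    [m + n]; this orders [I] so that its sums have sequences of partial sums. *)
Lemma mem_pmap_pickle_inv m n (i : I) :
  (i \in pmap (@pickle_inv I) (iota m n)) = (m <= pickle i < m + n)%N.
Proof.
rewrite mem_pmap -mem_iota; apply/mapP/idP => [[k kn /esym ik]|ki].
  by have := @pickle_invK I k; rewrite ik /= => ->.
by exists (pickle i) => //; rewrite pickleK_inv.
Qed.

Lemma uniq_pmap_pickle_inv m n : uniq (pmap (@pickle_inv I) (iota m n)).
Proof.
apply: (@pmap_uniq _ _ (@pickle_inv I) pickle); last exact: iota_uniq.
exact: (@pickle_invK I).
Qed.

(** Partial sums of [c i *: e i] along the enumeration of [I] form a Cauchy
    sequence, since by orthonormality their squared distances are differences
    of the bounded monotone sequence [r]. *)
Lemma riesz_fischer e c (M : R) : orthonormal_family inner e ->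
  (forall s, uniq s -> \sum_(i <- s) rnorm (c i) ^+ 2 <= M) ->
  exists y, (forall i, <|y, e i|> = c i) /\ rnorm y ^+ 2 <= M.
Proof.
move=> eo cM.
have M0 : 0 <= M by have := cM [::] isT; rewrite big_nil.
pose u n := \sum_(i <- pmap (@pickle_inv I) (iota 0 n)) c i *: e i.
pose r n := \sum_(i <- pmap (@pickle_inv I) (iota 0 n)) rnorm (c i) ^+ 2.
pose tl m n := pmap (@pickle_inv I) (iota m (n - m)).
have cat_tl m n : (m <= n)%N ->
    pmap (@pickle_inv I) (iota 0 n) = pmap (@pickle_inv I) (iota 0 m) ++ tl m n.
  by move=> mn; rewrite -{1}(subnKC mn) iotaD pmap_cat.
have uB m n : (m <= n)%N -> rnorm (u n - u m) ^+ 2 = r n - r m.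
  move=> mn; rewrite /u /r (cat_tl m n mn) !big_cat /= ![_ + _ - _]addrAC !subrr !add0r.
  by rewrite sqr_rnorm_orthonormal_sum// uniq_pmap_pickle_inv.
have r_incr : {homo r : m n / (m <= n)%N >-> m <= n}.
  by move=> m n mn; rewrite -subr_ge0 -uB// sqr_ge0.
have rM n : r n <= M by apply: cM; apply: uniq_pmap_pickle_inv.
have [|y uy] := complete_tends (u := u).
  move=> eps eps0.
  have [N rN] := bounded_monotone_cauchy r_incr rM (exprn_gt0 2 eps0).
  exists N => m n Nm mn; rewrite -ler_sqr ?nnegrE ?rnorm_ge0 ?(ltW eps0)// uB//.
  exact: rN.
exists y; split=> [i|].
  apply: tends_unique (tends_ipl Hinner (e i) uy) _ => eps eps0.
  exists (pickle i).+1 => n ni; rewrite ip_orthonormal_sum ?uniq_pmap_pickle_inv//.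
  by rewrite mem_pmap_pickle_inv add0n ni subrr rnorm0 ltW.
rewrite -[M]sqr_sqrtr// ler_sqr ?nnegrE ?rnorm_ge0 ?sqrtr_ge0//.
apply: tends_le uy _ => n.
rewrite -ler_sqr ?nnegrE ?rnorm_ge0 ?sqrtr_ge0// sqr_sqrtr//.
by rewrite sqr_rnorm_orthonormal_sum ?uniq_pmap_pickle_inv//; apply: rM.
Qed.

(** [C] is the analysis operator of [f] read in the basis [e]; it is linear
    because a vector is determined by its coefficients.  When [f i = T (e i)] it
    is the adjoint of [T], and when [f] is another orthonormal basis it is the
    unitary operator carrying [f] to [e]. *)
Lemma coefficient_operator e f (B : R) : orthonormal_basis inner e ->
  (forall x s, uniq s -> \sum_(i <- s) rnorm <|x, f i|> ^+ 2 <= B * rnorm x ^+ 2) ->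
  exists C : {linear H -> H},
    (forall x, rnorm (C x) ^+ 2 <= B * rnorm x ^+ 2) /\
    forall x i, <|C x, e i|> = <|x, f i|>.
Proof.
move=> eb fB.
have /choice[F FP] x := riesz_fischer (c := fun i => <|x, f i|>) (proj1 eb) (fB x).
have [|C CF] := linear_bundle (F := F).
  move=> a x y; apply/eqP; rewrite -subr_eq0; apply/eqP.
  apply: (orthonormal_basis_total eb) => i.
  rewrite ipBl ipDl ipZl.
  by rewrite (FP _).1 (FP x).1 (FP y).1 ipDl ipZl subrr.
by exists C; split=> x *; rewrite CF; case: (FP x).
Qed.

Lemma bounded_of_sqr (C : {linear H -> H}) (B : R) :
  (forall x, rnorm (C x) ^+ 2 <= B * rnorm x ^+ 2) -> bounded_operator C.
Proof.
move=> CB; exists (`|B| + 1) => x.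
rewrite -ler_sqr ?nnegrE ?rnorm_ge0 ?mulr_ge0 ?rnorm_ge0 ?addr_ge0// exprMn.
apply: le_trans (CB x) _; rewrite ler_wpM2r ?sqr_ge0//.
by have := ler_norm B; have := normr_ge0 B; nra.
Qed.

Lemma frame_upper f (M : R) x s :
  (\esum_(i in [set: I]) (rnorm <|x, f i|> ^+ 2)%:E <= M%:E)%E -> uniq s ->
  \sum_(i <- s) rnorm <|x, f i|> ^+ 2 <= M.
Proof.
move=> fM us; rewrite -lee_fin; apply: le_trans fM; apply: esum_ge.
exists [set` s]%classic; first by split=> //; apply: finite_seq.
by rewrite -fsbig_seq// -sumEFin.
Qed.

Lemma frame_lower f (m : R) x :
  (forall s, uniq s -> \sum_(i <- s) rnorm <|x, f i|> ^+ 2 <= m) ->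
  (\esum_(i in [set: I]) (rnorm <|x, f i|> ^+ 2)%:E <= m%:E)%E.
Proof.
move=> fm; apply: ge_ereal_sup => _ [X [Xf _] <-].
rewrite fsbig_finite//.
by have := fm _ (finmap.fset_uniq (fset_set X)); rewrite -lee_fin -sumEFin.
Qed.

End Families.

(** * Riesz bases and sums of orthonormal bases *)

Section SumsOfBases.
Variables (R : realType) (H : completeNormedModType R[i]).
Variables (inner : {dot H for Num.conj}) (Hinner : induces_norm inner).
Variable I : countType.
Implicit Types e f g h : I -> H.
Local Notation "<| x , y |>" := (inner x y) (at level 0, x, y at level 99).

Lemma dense_of_tends (S : set H) :
  (forall z, exists w : nat -> H, (forall n, S (w n)) /\ tends w z) -> dense S.
Proof.
move=> Sw O [y Oy] Oopen.
have /nbhs_ballP[eps /= eps0 epsO] : nbhs y O by apply: open_nbhs_nbhs.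
have epsR : eps = (complex.Re eps)%:C by rewrite RRe_real// ger0_real// ltW.
rewrite epsR ltcR in eps0.
have [w [wS /(_ (complex.Re eps / 2))[|N wN]]] := Sw y; first by lra.
exists (w N); split=> //; apply: epsO.
rewrite -ball_normE /ball_ /= normr_rnorm rdistC epsR ltcR.
by have := wN N (leqnn _); lra.
Qed.

Lemma unitary_image_basis e (U : {linear H -> H}) : orthonormal_basis inner e ->
  bounded_operator U -> (forall x y, <|U x, U y|> = <|x, y|>) ->
  (forall y, exists x, U x = y) -> orthonormal_basis inner (fun i => U (e i)).
Proof.
move=> [eo ed] Ub Uip Uonto; split; first by move=> i j; rewrite Uip eo.
apply: dense_of_tends => y; have [x <-] := Uonto y.
have [w [wS wx]] := dense_tends x ed.
exists (fun n => U (w n)); split; last exact: tends_bounded.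
move=> n; have [s [c ->]] := wS n; exists s, c.
by rewrite linear_sum; apply: eq_bigr => i _; rewrite linearZ.
Qed.

(** [W] and [V] are the coefficient operators for the two orders of the bases;
    comparing coefficients shows that they are inverse and adjoint to each
    other. *)
Lemma change_of_basis g h : orthonormal_basis inner g -> orthonormal_basis inner h ->
  exists W V : {linear H -> H},
    [/\ bounded_operator W, bounded_operator V, adjoint_pair inner W V,
        cancel V W & cancel W V] /\ forall i, W (g i) = h i.
Proof.
move=> gb hb.
have coef (p q : I -> H) : orthonormal_basis inner p -> orthonormal_basis inner q ->
    exists C : {linear H -> H}, [/\ bounded_operator C,
      forall x i, <|C x, q i|> = <|x, p i|> & forall i, C (p i) = q i].
  move=> pb qb.
  have [|C [Cn CE]] := coefficient_operator Hinner (f := p) (B := 1) qb.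
    by move=> x s us; rewrite mul1r; apply: bessel => //; case: pb.
  exists C; split=> // [|j]; first exact: bounded_of_sqr Cn.
  apply/eqP; rewrite -subr_eq0; apply/eqP/(orthonormal_basis_total Hinner qb) => i.
  by rewrite ipBl CE (proj1 pb) (proj1 qb) subrr.
have [W [Wb WE Wg]] := coef g h gb hb; have [V [Vb VE Vh]] := coef h g hb gb.
exists W, V; split=> //; split=> //.
- by apply: (adjoint_on_basis Hinner hb Vb) => x i; rewrite Vh WE.
- move=> x; apply/eqP; rewrite -subr_eq0; apply/eqP.
  by apply: (orthonormal_basis_total Hinner hb) => i; rewrite ipBl WE VE subrr.
- move=> x; apply/eqP; rewrite -subr_eq0; apply/eqP.
  by apply: (orthonormal_basis_total Hinner gb) => i; rewrite ipBl VE WE subrr.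
Qed.

Lemma bounded_linear_comb (a b : R[i]) (A B : {linear H -> H}) :
  bounded_operator A -> bounded_operator B -> exists L : {linear H -> H},
  bounded_operator L /\ forall x, L x = a *: A x + b *: B x.
Proof.
move=> [m Am] [n Bn].
have [|L LE] := linear_bundle (F := fun x => a *: A x + b *: B x).
  move=> c x y; rewrite [A _]linearP [B _]linearP !scalerDr !scalerA addrACA.
  by rewrite !(mulrC c).
exists L; split=> //; exists (rnorm a * m + rnorm b * n) => x; rewrite LE.
apply: le_trans (rnormD _ _) _; rewrite !rnormZ mulrDl -!mulrA.
by apply: lerD; apply: ler_wpM2l; rewrite ?rnorm_ge0.
Qed.

Lemma bounded_id : bounded_operator (idfun : {linear H -> H}).
Proof. by exists 1 => x; rewrite mul1r. Qed.

(** The operator [T = a + b W] is normal, so the lower bound that the frame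
    inequality gives for its adjoint also holds for [T]. *)
Lemma sum_of_bases_riesz f g h (a b : R[i]) : frame inner f ->
  orthonormal_basis inner g -> orthonormal_basis inner h ->
  (forall i, f i = a *: g i + b *: h i) -> riesz_basis inner f.
Proof.
move=> [A [B [A0 _ fAB]]] gb hb fE.
have [W [V [[Wb Vb WV WK VK] Wg]]] := change_of_basis gb hb.
have [T [Tb TE]] := bounded_linear_comb a b bounded_id Wb.
have [T' [Tb' TE']] := bounded_linear_comb (Num.conj a) (Num.conj b) bounded_id Vb.
have TT : adjoint_pair inner T T'.
  by move=> x y; rewrite TE TE' ipDl ipDr !ipZl !ipZr !conjCK WV.
(* both sides are [(|a|^2 + |b|^2) x] plus the two mixed terms *)
have TC x : T (T' x) = T' (T x).
  rewrite [LHS]TE [RHS]TE' /= [W (T' x)](_ : _ = Num.conj a *: W x + Num.conj b *: x).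
    rewrite [V (T x)](_ : _ = a *: V x + b *: x).
      rewrite TE TE' /= !scalerDr !scalerA !addrA.
      rewrite ![_ * a]mulrC ![_ * b]mulrC.
      by rewrite -!addrA; congr (_ + _); rewrite addrCA.
    by rewrite TE linearD !linearZ /= VK.
  by rewrite TE' linearD !linearZ /= WK.
have T'low x : A * rnorm x ^+ 2 <= rnorm (T' x) ^+ 2.
  rewrite -lee_fin; apply: le_trans (fAB x).1 _.
  apply: frame_lower => s us; apply: le_trans (bessel Hinner (T' x) (proj1 gb) us).
  apply: ler_sum => i _; rewrite fE -Wg.
  by rewrite (adjoint_pairC TT) TE.
have normT x : rnorm (T x) ^+ 2 = rnorm (T' x) ^+ 2.
  by rewrite !(sqr_rnorm Hinner) TT -TC -(adjoint_pairC TT).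
have onto y : exists x, T x = y.
  have [L [Lb LE]] : exists L : {linear H -> H}, bounded_operator L /\ L =1 T \o T'.
    by exists (T \o T'); split; first exact: bounded_comp.
  have [|S [_ _ SK]] := lax_milgram Hinner A0 Lb.
    by move=> x; rewrite LE /= TT -(sqr_rnorm Hinner).
  by exists (T' (S y)); rewrite -[RHS]SK LE.
have Tlow x : Num.sqrt A * rnorm x <= rnorm (T x).
  rewrite -ler_sqr ?nnegrE ?mulr_ge0 ?rnorm_ge0 ?sqrtr_ge0//.
  by rewrite exprMn sqr_sqrtr ?(ltW A0)// normT.
have [|S Sinv] := bounded_below_inverse _ Tlow onto; first by rewrite sqrtr_gt0.
exists g, T; split=> // [|i]; first by split=> //; exists S.
by rewrite TE Wg fE.
Qed.

(** [T P] is unitary as soon as [P P' = P' P = (T' T)^-1], with [C = T'] the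
    adjoint of [T] and [P'] that of [P], and [P] commutes with [T' T]. *)
Lemma unitary_of_factor (C T P P' N : {linear H -> H}) :
  adjoint_pair inner C T -> (forall y, exists x, T x = y) ->
  adjoint_pair inner P P' ->
  (forall x, P (P' x) = N x) -> (forall x, P' (P x) = N x) ->
  (forall x, C (T (P x)) = P (C (T x))) ->
  (forall x, N (C (T x)) = x) ->
  (forall x y, <|T (P x), T (P y)|> = <|x, y|>) /\
  (forall y, exists x, T (P x) = y).
Proof.
move=> CT Tonto PP PPN PPN' GP NG; split=> [x y|y].
  have GPP : P' (C (T (P x))) = x by rewrite GP PPN' NG.
  by rewrite -CT -(adjoint_pairC PP) GPP.
by have [z <-] := Tonto y; exists (P' (C (T z))); rewrite PPN NG.
Qed.

(** [N = (T' T)^-1] is coercive, hence so is [N - k] for a small [k = c^2]; with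
    [K] its square root, [T (c + s K)] is unitary for [s] equal to [i] and [-i],
    and the two sum to [2 c T].  The upper frame bound provides the adjoint [C]
    of [T] as a coefficient operator. *)
Lemma riesz_sum_of_bases f : frame inner f -> riesz_basis inner f ->
  exists (a b : R[i]) (g h : I -> H),
     [/\ orthonormal_basis inner g, orthonormal_basis inner h
       & forall i : I, f i = a *: g i + b *: h i].
Proof.
move=> [A [B [_ _ fAB]]] [e [T [eb [Tb [S [Sb TS ST]]] Te]]].
have [C [Cn CE]] : exists C : {linear H -> H},
    (forall x, rnorm (C x) ^+ 2 <= B * rnorm x ^+ 2) /\
    forall x i, <|C x, e i|> = <|x, f i|>.
  by apply: (coefficient_operator Hinner eb) => x s; apply: frame_upper; exact: (fAB x).2.
have Cb := bounded_of_sqr Cn.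
have CT : adjoint_pair inner C T.
  by apply: (adjoint_on_basis Hinner eb Tb) => x i; rewrite CE Te.
pose G : {linear H -> H} := C \o T.
have Gb : bounded_operator G by apply: bounded_comp.
have Gadj : adjoint_pair inner G G by move=> x y; rewrite /G /= CT -(adjoint_pairC CT).
have [m [m0 Sm]] := bounded_pos Sb.
pose d := m ^- 2; have d0 : 0 < d by rewrite invr_gt0 exprn_gt0.
(* [|x| = |S (T x)| <= m |T x|] *)
have Tlow x : d * rnorm x ^+ 2 <= rnorm (T x) ^+ 2.
  rewrite mulrC ler_pdivrMr ?exprn_gt0// mulrC -exprMn.
  by rewrite ler_sqr ?nnegrE ?mulr_ge0 ?rnorm_ge0 ?(ltW m0)// -{1}(TS x).
have GT x : complex.Re <|G x, x|> = rnorm (T x) ^+ 2.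
  by rewrite (sqr_rnorm Hinner) /G /= CT.
have [|N [Nb GN NG]] := lax_milgram Hinner d0 Gb.
  by move=> x; rewrite GT.
have Nadj : adjoint_pair inner N N.
  by move=> x y; rewrite -[in LHS](NG y) -Gadj NG.
have [p [p0 Gp]] := bounded_pos Gb.
(* half of the coercivity constant [d / p^2] of [N], so that [N - k] keeps the
   other half *)
pose k := d / p ^+ 2 / 2.
have k0 : 0 < k by rewrite !divr_gt0 ?exprn_gt0.
have [M [Mb ME]] := bounded_linear_comb 1 (- k%:C) Nb bounded_id.
have Ncoer x : (k + k) * rnorm x ^+ 2 <= complex.Re <|N x, x|>.
  have -> : <|N x, x|> = <|G (N x), N x|> by rewrite Gadj NG.
  rewrite GT; apply: le_trans (Tlow _).
  have -> : k + k = d / p ^+ 2 by rewrite /k; field; rewrite gt_eqF.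
  rewrite -mulrA ler_pM2l// mulrC ler_pdivrMr ?exprn_gt0// mulrC -exprMn.
  by rewrite ler_sqr ?nnegrE ?mulr_ge0 ?rnorm_ge0 ?(ltW p0)// -{1}(NG x).
have ME' x : M x = N x - k%:C *: x by rewrite ME /= scale1r scaleNr.
have [||K [Kb Kadj KK Kc]] := coercive_sqrt Hinner k0 Mb.
- move=> x; rewrite ME' ipBl ipZl raddfB /= ReM_real -(sqr_rnorm Hinner).
  by have := Ncoer x; lra.
- by move=> x y; rewrite !ME' ipBl ipBr ipZl ipZr conjR Nadj.
have GK x : G (K x) = K (G x).
  by apply: Kc => // z; rewrite !ME' [G (_ - _)]linearB [G (_ *: _)]linearZ GN NG.
pose c := Num.sqrt k; have cc : c ^+ 2 = k by rewrite sqr_sqrtr// ltW.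
have c0 : 0 < c by rewrite sqrtr_gt0.
have half (s : R[i]) : Num.conj s = - s -> s * s = -1 ->
    exists P : {linear H -> H}, (forall x, P x = c%:C *: x + s *: K x) /\
      orthonormal_basis inner (fun i => T (P (e i))).
  move=> sJ ss.
  have [P [Pb PE]] := bounded_linear_comb c%:C s bounded_id Kb.
  have [P' [P'b P'E]] := bounded_linear_comb c%:C (- s) bounded_id Kb.
  exists P; split=> //.
  have CN x : c%:C *: (c%:C *: x) + K (K x) = N x.
    by rewrite scalerA -rmorphM -expr2 cc KK ME' addrC subrK.
  have [||||||Uip Uonto] := @unitary_of_factor C T P P' N CT.
  - by move=> y; exists (S y).
  - move=> x y; rewrite PE P'E /= ipDl ipDr !ipZl !ipZr conjR.
    by rewrite [Num.conj (- s)]rmorphN /= sJ opprK Kadj.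
  - move=> x; rewrite PE P'E /= [K (_ + _)]linearD ![K (_ *: _)]linearZ /= -CN.
    rewrite !scalerDr ![s *: _]scalerA mulrN ss opprK scale1r (mulrC s) -scalerA.
    by rewrite addrA scaleNr scalerN subrK.
  - move=> x; rewrite PE P'E /= [K (_ + _)]linearD ![K (_ *: _)]linearZ /= -CN.
    rewrite !scalerDr ![(- s) *: _]scalerA !mulNr ss opprK scale1r (mulrC s) scaleNr.
    by rewrite -scalerA addrA addrK.
  - by move=> x; rewrite !PE -[LHS]/(G _) [G _]linearD ![G (_ *: _)]linearZ GK.
  - exact: GN.
  have [U UE] : exists U : {linear H -> H}, bounded_operator U /\ U =1 T \o P.
    by exists (T \o P); split; first exact: bounded_comp.
  have := unitary_image_basis eb UE.1.
  have -> : (fun i => U (e i)) = (fun i => T (P (e i))) by apply/funext => i; rewrite UE.2.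
  apply=> [x y|y]; first by rewrite !UE.2 /= Uip.
  by have [x <-] := Uonto y; exists x; rewrite UE.2.
have iJ : Num.conj ('i%R : R[i]) = - 'i%R := conjCi _.
have ii : 'i%R * 'i%R = -1 :> R[i] by rewrite -expr2 sqrCi.
have [P [PE Pb]] := half 'i%R iJ ii.
have [|Q [QE Qb]] := half (- 'i%R) _ (etrans (mulrNN _ _) ii); first by rewrite rmorphN /= iJ.
exists ((2 * c)^-1)%:C, ((2 * c)^-1)%:C.
exists (fun i => T (P (e i))), (fun i => T (Q (e i))); split=> // i.
rewrite -scalerDr -linearD PE QE addrACA scaleNr subrr addr0 -scalerDl.
rewrite -rmorphD linearZ /= scalerA -rmorphM.
by rewrite (_ : (2 * c)^-1 * (c + c) = 1) ?scale1r ?Te//; field; rewrite gt_eqF.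
Qed.

End SumsOfBases.

Theorem proposition2p5 (R : realType) (H : completeNormedModType R[i])
    (inner : {dot H for Num.conj}) (Hinner : induces_norm inner)
    (I : countType) (f : I -> H) (Hf : frame inner f) :
  (exists (a b : R[i]) (g h : I -> H),
     [/\ orthonormal_basis inner g, orthonormal_basis inner h
       & forall i : I, f i = a *: g i + b *: h i])
  <-> riesz_basis inner f.
Proof.
split; last exact: riesz_sum_of_bases.
by move=> [a [b [g [h [gb hb fE]]]]]; apply: sum_of_bases_riesz fE.
Qed.
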